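(* (i) Suppose that $g\equiv 1\pmod 6$ and $m\equiv 4\pmod 6$, or that $g\equiv 5\pmod 6$ and $m\equiv 2\pmod 6$. Suppose also that $u\in\{21,33\}$ and $g\le m\le g(u-1)/2$. Then there exists a 4-GDD of type $g^u m^1$. (ii) Suppose $g\equiv 1$ or $11\pmod{30}$ and $m\equiv g\pmod 3$. Then there exists a 4-GDD of type $g^{24}m^1$ for every such $m$ with $g\le m\le (56g-6)/5$.
   Context: Here $g,m$ are positive integers. A 4-GDD of type $g_1^{u_1}\cdots g_r^{u_r}$ is a triple $(V,\mathcal G,\mathcal B)$ where $V$ is a set of $u_1g_1+\cdots+u_rg_r$ points, $\mathcal G$ is a partition of $V$ into $u_i$ groups of size $g_i$ for each $i$, and $\mathcal B$ is a non-empty collection of 4-element subsets (blocks) such that every pair of points from distinct groups lies in exactly one block and no pair from the same group lies in any block. *)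

(* Defs.v *)
From mathcomp Require Import all_boot.
Set Implicit Arguments. Unset Strict Implicit. Unset Printing Implicit Defensive.

Definition is_4GDD (V : finType) (G : {set {set V}}) (B : seq {set V}) : Prop :=
  [/\ partition G [set: V],
      B != [::],
      (forall b, b \in B -> #|b| = 4),
      (forall x y : V, x != y -> pblock G x != pblock G y ->
         count (fun b : {set V} => (x \in b) && (y \in b)) B = 1)
    & (forall x y : V, x != y -> pblock G x = pblock G y ->
         count (fun b : {set V} => (x \in b) && (y \in b)) B = 0)].

(* The group type g_1^{u_1} ... g_r^{u_r} is given as the list of (g_i, u_i). *)
Definition gdd_type_seq (t : seq (nat * nat)) : seq nat :=
  flatten [seq nseq p.2 p.1 | p <- t].

Definition exists_4GDD (t : seq (nat * nat)) : Prop :=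
  exists (n : nat) (G : {set {set 'I_n}}) (B : seq {set 'I_n}),
    is_4GDD G B /\ perm_eq [seq #|A| | A : {set 'I_n} <- enum G] (gdd_type_seq t).

(* Main.v *)
(* Blow up u points to copies of A = Z/g with g = 2k + 1, and let the m further
   points be the parallel classes of a system of triples on {1, ..., u} x A
   whose remaining pairs are covered by quadruples.  The blocks
   are the A-translates of base blocks {(x, s p_x)}, where s runs through 0 and
   1, ..., k and the integers p_x come from a "template", a fixed design on u
   points.  For s = 0 the template covers every pair x, y once.  For s > 0 it
   covers every pair twice, with opposite differences c and -c, where c = c(x, y)
   is a product of primes not dividing g; then the differences 0, sc and -sc
   (1 <= s <= k) exhaust A, so that every pair of points is in one block.  As long
   as c(x, y) is the same for two templates with a and b parallel classes, each s
   can use either of them, which makes m vary from m0 + ka to m0 + kb in steps of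
   b - a; the templates for s = 0 fill the gaps. *)
Require Import Defs.
From mathcomp Require Import all_boot all_algebra zify.
Set Implicit Arguments. Unset Strict Implicit. Unset Printing Implicit Defensive.
Import GRing.Theory.

(** * From coloured points to group divisible designs *)

Section ColouredBlocks.
Variables (T K : finType) (f : T -> K) (B : seq {set T}).
Hypothesis f_surj : forall k, exists v, f v = k.
Hypothesis B_nil : B != [::].
Hypothesis B_card : forall b, b \in B -> #|b| = 4.
Hypothesis B_count : forall v w, v != w ->
  count (fun b : {set T} => (v \in b) && (w \in b)) B = (f v != f w).

(** The groups are the fibres of [f], and the enumeration of [T] carries everything over to an
    ordinal. [B_count] combines both pair conditions, its right-hand side being a boolean read as 0
    or 1. *)
Lemma coloured_4GDD (t : seq (nat * nat)) :
  perm_eq [seq #|[set v | f v == k]| | k <- enum K] (gdd_type_seq t) ->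
  exists_4GDD t.
Proof.
move=> Ht; pose h := @enum_val T T : 'I_#|T| -> T.
have h_inj : injective h by exact: enum_val_inj.
have h_bij : bijective h by exact: enum_val_bij.
pose fh i := f (h i); pose G := preim_partition fh [set: 'I_#|T|].
have partG : partition G [set: 'I_#|T|] := preim_partitionP fh _.
have pbE x y : (pblock G x == pblock G y) = (fh x == fh y).
  have [/eqP covG tiG _] := and3P partG.
  rewrite eq_pblock ?covG ?inE //.
  rewrite (pblock_equivalence_partition (R := fun x y => fh x == fh y)) ?inE //.
  by split=> // /eqP->.
have cpre (b : {set T}) : #|h @^-1: b| = #|b|.
  by apply: on_card_preimset; exact: onW_bij.
exists #|T|, G, [seq h @^-1: b | b : {set T} <- B]; split; first split => //.
- by case: (B) B_nil.
- by move=> b /mapP [b' /B_card <- ->].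
- move=> x y nxy npb; rewrite count_map -[RHS]/(true : nat).
  rewrite -[in RHS]npb pbE -[fh x]/(f (h x)) -B_count ?(inj_eq h_inj) //.
  by apply: eq_count => b /=; rewrite !inE.
- move=> x y nxy /eqP; rewrite pbE => /eqP fxy; rewrite count_map.
  have -> : 0 = (f (h x) != f (h y)) by rewrite -/(fh x) fxy eqxx.
  rewrite -B_count ?(inj_eq h_inj) //.
  by apply: eq_count => b /=; rewrite !inE.
(* Surjectivity of [f] makes the fibres non-empty, hence pairwise distinct, so the set of groups
   corresponds to the list of colours without repetition. *)
apply: perm_trans Ht; pose F k := [set i | fh i == k].
have [w _ hK] := h_bij.
have Finj : injective F.
  move=> k l /setP E; have [v fv] := f_surj k.
  by have := E (w v); rewrite !inE /fh hK fv eqxx => /esym/eqP.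
have -> : [seq #|[set v | f v == k]| | k <- enum K] =
    [seq #|A| | A : {set 'I_#|T|} <- map F (enum K)].
  rewrite -[RHS]map_comp; apply: eq_map => k /=.
  by rewrite -cpre; congr #|pred_of_set _|; apply/setP => i; rewrite !inE.
apply: perm_map; apply: uniq_perm; first exact: enum_uniq.
  by rewrite map_inj_uniq ?enum_uniq.
move=> A; rewrite mem_enum; apply/imsetP/mapP => [[x _ ->]|[k _ ->]].
  exists (fh x); rewrite ?mem_enum //; apply/setP => y.
  by rewrite !inE eq_sym.
have [v fv] := f_surj k.
exists (w v); rewrite ?inE //; apply/setP => y.
by rewrite !inE /fh hK fv eq_sym.
Qed.
End ColouredBlocks.

(** * Developing base blocks over an abelian group *)

Section Development.
Variables (u m : nat) (A : finZmodType).
Notation block := (seq ('I_u * A)).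
Variables (C : seq (seq block)) (Q : seq block).

(** The mixed difference [d] from [x] to [y] occurs in [b]: some translate of [b] contains both (x,
    a) and (y, a + d), for any given a. *)
Definition covers (x y : 'I_u) (d : A) (b : block) :=
  has (fun p => (p.1 == x) && ((y, p.2 + d)%R \in b)) b.

Hypothesis Cn : size C = m.
Hypothesis m_gt0 : 0 < m.
Hypothesis u_gt0 : 0 < u.
Hypothesis C_uniq : forall c b, c \in C -> b \in c -> uniq (map fst b) && (size b == 3).
Hypothesis Q_uniq : forall b, b \in Q -> uniq (map fst b) && (size b == 4).
Hypothesis C_par : forall c x, c \in C -> count (fun b : block => x \in map fst b) c = 1.
Hypothesis CQ_cov : forall x y d, x != y -> count (covers x y d) (flatten C ++ Q) = 1.

Let T : finType := (('I_u * A) + 'I_m)%type.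

(** With [o = Some j] the translate of a triple of class [j] is completed by the infinite point [j];
    quadruples use [o = None]. *)
Definition devpt (o : option 'I_m) (b : block) (t : A) : seq T :=
  [seq inl (p.1, p.2 + t)%R | p <- b] ++ (if o is Some j then [:: inr j] else [::]).

Definition devblock o b t : {set T} := [set v in devpt o b t].

Lemma mem_devpt_l o b t x a : (inl (x, a) \in devpt o b t) = ((x, a - t)%R \in b).
Proof.
rewrite mem_cat.
have -> : (inl (x, a) \in (if o is Some j then [:: inr j] else [::] : seq T)) = false.
  by case: o.
rewrite orbF; apply/mapP/idP => [[[y e] yb [-> ->]]|xb]; first by rewrite addrK.
by exists (x, a - t)%R; rewrite //= subrK.
Qed.

Lemma mem_devpt_r o b t j : (inr j \in devpt o b t) = (o == Some j).
Proof.
rewrite mem_cat; have -> :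
    (inr j \in ([seq inl (p.1, p.2 + t)%R | p <- b] : seq T)) = false.
  by apply/negP => /mapP [].
by case: o => [i|] //=; rewrite inE eq_sym.
Qed.

Lemma card_devblock o b t : uniq (map fst b) -> #|devblock o b t| = size b + (o != None).
Proof.
move=> Ub; rewrite cardsE; have /card_uniqP E : uniq (devpt o b t).
  rewrite cat_uniq map_inj_in_uniq ?(map_uniq Ub) /=; last first.
    by move=> [x a] [y e] _ _ [-> /addIr ->].
  by case: o => [j|] //=; rewrite andbT orbF; apply/negP => /mapP [].
by rewrite E size_cat size_map; case: (o).
Qed.

Lemma uniq_fst_inj (b : block) x a e :
  uniq (map fst b) -> (x, a) \in b -> (x, e) \in b -> a = e.
Proof.
elim: b => //= -[y c] b IH /andP[yb /IH{}IH]; rewrite !inE.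
have nb z : (y, z) \in b -> False.
  by move=> yz; move/negP: yb; apply; apply/mapP; exists (y, z).
case/predU1P => [[-> ->]|xb]; first by case/predU1P => [[->]|/nb].
by case/predU1P => [[xy _]|/IH]; [case: (nb a); rewrite -xy | exact].
Qed.

(** Translation acts regularly on the copies of [x], and [b] has at most one of them, so at most one
    translate passes through (x, a). *)
Lemma sum_fst (b : block) x a :
  uniq (map fst b) -> \sum_(t : A) ((x, a - t)%R \in b : nat) = (x \in map fst b).
Proof.
move=> Ub; case: (boolP (x \in map fst b)) => [/mapP [[y c] yb /= ->]|nx].
  rewrite (bigD1 (a - c)%R) //= opprB addrCA subrr addr0 yb big1 // => t nt.
  case: (boolP (_ \in b)) => // /(uniq_fst_inj Ub yb) E.
  by move: nt; rewrite E opprB addrCA subrr addr0 eqxx.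
rewrite big1 // => t _; case: (boolP (_ \in b)) => // xb.
by case/negP: nx; apply/mapP; exists (x, a - t)%R.
Qed.

Lemma sum_covers (b : block) x y a e :
  uniq (map fst b) ->
  \sum_(t : A) (((x, a - t)%R \in b) && ((y, e - t)%R \in b) : nat) = covers x y (e - a)%R b.
Proof.
move=> Ub; case: (boolP (covers _ _ _ b)) => [/hasP [[z c] zb /= /andP[/eqP zx yb]]|nc].
  (* The translation by [a - c] is the only one that takes (x, c) to (x, a). *)
  subst z; rewrite (bigD1 (a - c)%R) //= opprB addrCA subrr addr0 zb /=.
  rewrite addrCA yb.
  rewrite big1 // => t nt; case: (boolP ((x, _) \in b)) => // /(uniq_fst_inj Ub zb) E.
  by move: nt; rewrite E opprB addrCA subrr addr0 eqxx.
rewrite big1 // => t _; apply/eqP; rewrite eqb0; apply: contra nc => /andP[xb yb].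
apply/hasP; exists (x, a - t)%R => //=; rewrite eqxx /=.
by rewrite addrC addrA subrK.
Qed.

Definition devblocks : seq {set T} :=
  [seq devblock None b t | b <- Q, t <- enum A] ++
  flatten [seq [seq devblock (Some j) b t | b <- nth [::] C j, t <- enum A] | j <- enum 'I_m].

Lemma count_sum (S : Type) (P : pred S) s : count P s = \sum_(x <- s) (P x : nat).
Proof. by rewrite -sum1_count big_mkcond. Qed.

Lemma count_allpairs_sum (S1 S2 R : Type) (f : S1 -> S2 -> R) (P : pred R) s1 s2 :
  count P [seq f x y | x <- s1, y <- s2] = \sum_(x <- s1) \sum_(y <- s2) (P (f x y) : nat).
Proof.
rewrite count_flatten sumnE !big_map; apply: eq_bigr => x _.
by rewrite count_map count_sum.
Qed.

Lemma count_devblocks (P : pred {set T}) : count P devblocks =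
  \sum_(b <- Q) \sum_(t : A) (P (devblock None b t) : nat) +
  \sum_(j < m) \sum_(b <- nth [::] C j) \sum_(t : A) (P (devblock (Some j) b t) : nat).
Proof.
rewrite count_cat count_allpairs_sum count_flatten sumnE !big_map; congr (_ + _).
  by apply: eq_bigr => b _; rewrite big_enum.
rewrite -enumT big_enum; apply: eq_bigr => j _; rewrite count_allpairs_sum.
by apply: eq_bigr => b _; rewrite big_enum.
Qed.

Definition label (v : T) : option 'I_u := if v is inl p then Some p.1 else None.

Lemma nth_C (j : 'I_m) : nth [::] C j \in C.
Proof. by rewrite mem_nth // Cn. Qed.

Lemma count_pair_ll (x y : 'I_u) a e : (x, a) != (y, e) ->
  count (fun b : {set T} => (inl (x, a) \in b) && (inl (y, e) \in b)) devblocks = (x != y).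
Proof.
move=> nxy; rewrite count_devblocks.
have red o b t : (inl (x, a) \in devblock o b t) && (inl (y, e) \in devblock o b t)
    = ((x, a - t)%R \in b) && ((y, e - t)%R \in b).
  by rewrite !inE !mem_devpt_l.
have [xy|xy] := eqVneq x y; rewrite /=.
  (* A base block has at most one copy of [x], so no translate contains two points of the same
     group. *)
  subst y; rewrite !big1_seq //= => [j _|b bQ].
    rewrite big1_seq // => b bc; rewrite big1 // => t _; rewrite red.
    have /andP [Ub _] := C_uniq (nth_C j) bc.
    case: (boolP (_ \in b)) => // h1; case: (boolP (_ \in b)) => //= h2.
    by have /addIr E := uniq_fst_inj Ub h1 h2; rewrite E eqxx in nxy.
  rewrite big1 // => t _; rewrite red; have /andP [Ub _] := Q_uniq bQ.
  case: (boolP (_ \in b)) => // h1; case: (boolP (_ \in b)) => //= h2.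
  by have /addIr E := uniq_fst_inj Ub h1 h2; rewrite E eqxx in nxy.
(* Summing over translates turns each base block into its value of [covers] at the difference
   [e - a], which [CQ_cov] adds up to 1. *)
rewrite -(CQ_cov (e - a)%R xy) count_cat addnC count_flatten sumnE big_map; congr (_ + _).
  rewrite (big_nth [::]) Cn big_mkord; apply: eq_bigr => j _.
  rewrite [RHS]count_sum; apply: eq_big_seq => b bc.
  have /andP [Ub _] := C_uniq (nth_C j) bc.
  by rewrite -(sum_covers _ _ _ _ Ub); apply: eq_bigr => t _; rewrite red.
rewrite [RHS]count_sum; apply: eq_big_seq => b bQ.
have /andP [Ub _] := Q_uniq bQ.
by rewrite -(sum_covers _ _ _ _ Ub); apply: eq_bigr => t _; rewrite red.
Qed.

(** Only class [j] meets the infinite point [j]; since it is a parallel class, one of its triples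
    contains [x], and one translate of that triple passes through (x, a). *)
Lemma count_pair_lr (x : 'I_u) a j :
  count (fun b : {set T} => (inl (x, a) \in b) && (inr j \in b)) devblocks = 1.
Proof.
rewrite count_devblocks.
have red o b t : (inl (x, a) \in devblock o b t) && (inr j \in devblock o b t)
    = ((x, a - t)%R \in b) && (o == Some j).
  by rewrite !inE mem_devpt_l mem_devpt_r.
rewrite big1 => [|b _]; last by rewrite big1 // => t _; rewrite red andbF.
rewrite add0n (bigD1 j) //= [X in _ + X]big1 => [|i ij]; last first.
  rewrite big1 // => b _; rewrite big1 // => t _; rewrite red.
  have -> : (Some i == Some j) = (i == j) by [].
  by rewrite (negPf ij) andbF.
rewrite addn0 -(C_par x (nth_C j)) [RHS]count_sum.
apply: eq_big_seq => b bc; have /andP [Ub _] := C_uniq (nth_C j) bc.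
rewrite -(sum_fst x a Ub).
by apply: eq_bigr => t _; rewrite red eqxx andbT.
Qed.

Lemma count_pair_rr (i j : 'I_m) : i != j ->
  count (fun b : {set T} => (inr i \in b) && (inr j \in b)) devblocks = 0.
Proof.
move=> nij; rewrite count_devblocks !big1 // => [k|b] _; rewrite !big1 // => b' _.
  rewrite big1 // => t _; rewrite !inE !mem_devpt_r.
  by case: eqP => [[->]|] //=; case: eqP => // -[E]; rewrite E eqxx in nij.
by rewrite !inE !mem_devpt_r.
Qed.

(** The colour of a point is its [label]: the groups are the [u] copies of [A] and the set of
    infinite points, which has colour [None]. *)
Lemma development : exists_4GDD [:: (#|A|, u); (m, 1)].
Proof.
apply: (@coloured_4GDD _ _ label devblocks).
- case=> [x|]; first by exists (inl (x, 0%R)).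
  by exists (inr (Ordinal m_gt0)).
(* A finite and an infinite point exist and lie in a common block, so there is a block. *)
- apply/eqP => E; have := count_pair_lr (Ordinal u_gt0) 0%R (Ordinal m_gt0).
  by rewrite E.
- move=> b; rewrite mem_cat => /orP [/allpairsP [[c t] /= [cQ _ ->]]|].
    by have /andP [Ub /eqP E] := Q_uniq cQ; rewrite card_devblock // E.
  case/flattenP => s /mapP [j _ ->] /allpairsP [[c t] /= [cc _ ->]].
  by have /andP [Ub /eqP E] := C_uniq (nth_C j) cc; rewrite card_devblock // E.
- case=> [[x a]|i] [[y e]|j] nvw.
  + by rewrite count_pair_ll.
  + exact: count_pair_lr.
  + rewrite (eq_count (a2 := fun b : {set T} => (inl (y, e) \in b) && (inr i \in b))).
      exact: count_pair_lr.
    by move=> b; rewrite andbC.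
  + by rewrite count_pair_rr ?eqxx.
have Eo : perm_eq (enum {: option 'I_u}) (None :: map Some (enum 'I_u)).
  apply: uniq_perm; first exact: enum_uniq.
    rewrite /= map_inj_uniq ?enum_uniq ?andbT; last by move=> ? ? [].
    by apply/mapP => -[].
  move=> [x|]; rewrite mem_enum // inE.
  by apply/esym/mapP; exists x; rewrite ?mem_enum.
apply: perm_trans (perm_map _ Eo) _.
have -> : gdd_type_seq [:: (#|A|, u); (m, 1)] = nseq u #|A| ++ [:: m] by [].
rewrite perm_sym perm_catC /=.
have -> : #|[set v | label v == None]| = m.
  have -> : [set v | label v == None] = inr @: [set: 'I_m].
    apply/setP => -[p|j]; rewrite !inE; symmetry; last by apply/imsetP; exists j.
    by apply/imsetP => -[].
  by rewrite card_imset ?cardsT ?card_ord //; move=> ? ? [].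
rewrite perm_cons -map_comp.
suff /all_pred1P -> : all (pred1 #|A|)
    [seq ((fun k => #|[set v | label v == k]|) \o Some) i | i <- enum 'I_u].
  by rewrite size_map size_enum_ord.
apply/allP => _ /mapP [x _ ->] /=.
have -> : [set v | label v == Some x] = [set inl (x, a) | a : A].
  apply/setP => -[[y a]|j]; rewrite !inE.
    by apply/eqP/imsetP => [[->]|[e _ [-> _]]] //; exists a.
  by apply/esym/imsetP => -[].
by rewrite card_imset ?cardsT // => ? ? [].
Qed.
End Development.

(** * Templates *)

Section Templates.
(* An element (x, p) of a block is the point x with coefficient p; a template lists
   its parallel classes of triples, then its quadruples. *)
Definition base_block := seq (nat * nat).
Definition template := (seq (seq base_block) * seq base_block)%type.

Definition coef (x : nat) (b : base_block) : option nat :=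
  ohead [seq p.2 | p <- b & p.1 == x].

Definition joint_coefs (bs : seq base_block) (x y : nat) : seq (nat * nat) :=
  pmap (fun b => if (coef x b, coef y b) is (Some p, Some q) then Some (p, q) else None) bs.

Definition blocks_of (t : template) := flatten t.1 ++ t.2.

Definition well_formed (u n : nat) (b : base_block) :=
  [&& size b == n, uniq (map fst b) & all (fun p => p.1 < u) b].

Definition shape_ok (u : nat) (t : template) :=
  [&& all (all (well_formed u 3)) t.1, all (well_formed u 4) t.2 &
      all (fun c => perm_eq (map fst (flatten c)) (iota 0 u)) t.1].

Definition for_pairs (u : nat) (P : nat -> nat -> bool) :=
  all (fun x => all (fun y => (x == y) || P x y) (iota 0 u)) (iota 0 u).

(** A pairwise balanced design with blocks of sizes 3 and 4. Its coefficients are left unconstrained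
    because it is scaled by 0. *)
Definition simple_template (u : nat) (t : template) :=
  shape_ok u t && (let bs := blocks_of t in
    for_pairs u (fun x y => size (joint_coefs bs x y) == 1)).

(** The two differences q - p are c and -c in either order, written with sums because subtraction of
    natural numbers is truncated. *)
Definition opposite_by (c : nat) (s : seq (nat * nat)) :=
  if s is [:: (p1, q1); (p2, q2)] then
    (q1 == p1 + c) && (p2 == q2 + c) || (p1 == q1 + c) && (q2 == p2 + c)
  else false.

Definition signed_template (u : nat) (cs : seq nat) (cf : nat -> nat -> nat) (t : template) :=
  shape_ok u t && (let bs := blocks_of t in
    for_pairs u (fun x y => let c := cf x y in
      (c \in cs) && opposite_by c (joint_coefs bs x y))).

Lemma for_pairsP u P x y : for_pairs u P -> x < u -> y < u -> x != y -> P x y.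
Proof.
move=> /allP H xu yu nxy.
have /H /allP H' : x \in iota 0 u by rewrite mem_iota.
have /H' : y \in iota 0 u by rewrite mem_iota.
by rewrite (negPf nxy).
Qed.

(** * Scaling templates over the cyclic group of order 2k + 1 *)

Variables (u' k : nat).
(** Successors give ['I_u] the function [inord] and ['I_g] its group structure. *)
Let u := u'.+1.
Let g := k.*2.+1.
Let A : finZmodType := 'I_g.

Definition scale_block (s : A) (b : base_block) : seq ('I_u * A) :=
  [seq (inord p.1, s *+ p.2)%R | p <- b].

Lemma map_fst_scale s (b : base_block) :
  map fst (scale_block s b) = map inord (map fst b) :> seq 'I_u.
Proof. by rewrite -!map_comp. Qed.

Lemma inord_inj_in (s : seq nat) : all (fun x => x < u) s -> {in s &, injective (@inord u')}.
Proof. by move=> /allP H x y /H xu /H yu E; rewrite -(inordK xu) E inordK. Qed.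

Lemma well_formed_scale n s (b : base_block) :
  well_formed u n b -> uniq (map fst (scale_block s b)) && (size (scale_block s b) == n).
Proof.
move=> /and3P [/eqP Sb Ub Hb]; rewrite size_map Sb eqxx andbT map_fst_scale.
by rewrite map_inj_in_uniq //; apply: inord_inj_in; rewrite all_map.
Qed.

Lemma coef_mem n (b : base_block) x p :
  well_formed u n b -> ((x, p) \in b) = (coef x b == Some p).
Proof.
move=> /and3P [_ Ub _]; rewrite /coef; elim: b Ub => //= -[y q] b IH /= /andP [yb /IH{}IH].
rewrite inE IH xpair_eqE; have [->|nxy] := eqVneq x y; rewrite ?eqxx /=.
  have -> : [seq p0 <- b | p0.1 == y] = [::].
    apply/eqP; rewrite -[_ == _]negbK -has_filter; apply: contra yb.
    by case/hasP => r rb /eqP <-; exact: map_f.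
  by rewrite orbF; apply/eqP/eqP => [->|[->]].
by [].
Qed.

Lemma covers_scale n s (b : base_block) (x y : 'I_u) (d : A) : well_formed u n b ->
  covers x y d (scale_block s b) =
  if (coef x b, coef y b) is (Some p, Some q) then (s *+ p + d == s *+ q)%R else false.
Proof.
move=> wb; have /and3P [_ Ub Hb] := wb.
have memE (z : 'I_u) (e : A) : ((z, e) \in scale_block s b) =
    if coef z b is Some q then (e == s *+ q)%R else false.
  apply/mapP/idP => [[[z' q] zb [-> ->]]|].
    have zu : z' < u by move/allP: Hb => /(_ _ zb).
    by move: zb; rewrite (coef_mem _ _ wb) inordK // => /eqP ->.
  case E: (coef z b) => [q|] // /eqP ->; exists (val z, q); last by rewrite inord_val.
  by rewrite (coef_mem _ _ wb) E.
apply/hasP/idP => [[[z e] zb /= /andP [/eqP zx]]|].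
  subst z; move: zb; rewrite !memE; case: (coef x b) => // p /eqP ->.
  by case: (coef y b).
case Ex: (coef x b) => [p|] //; case Ey: (coef y b) => [q|] // /eqP E.
by exists (x, s *+ p)%R; rewrite /= ?eqxx memE ?Ex ?Ey //= E.
Qed.

(** This reduces coverage to arithmetic on the finite list [joint_coefs], which is what the computed
    checks inspect. *)
Lemma count_covers_scale s (t : template) (x y : 'I_u) (d : A) : shape_ok u t ->
  count (covers x y d) (map (scale_block s) (blocks_of t)) =
  count (fun pq => (s *+ pq.1 + d == s *+ pq.2)%R) (joint_coefs (blocks_of t) x y).
Proof.
move=> /and3P [H3 H4 _]; rewrite count_map.
have : all (fun b => well_formed u 3 b || well_formed u 4 b) (blocks_of t).
  rewrite all_cat; apply/andP; split; apply/allP => b.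
    by case/flattenP => c /(allP H3) /allP Hc /Hc ->.
  by move/(allP H4) => ->; rewrite orbT.
elim: (blocks_of t) => //= b bs IH /andP [wb /IH ->].
have -> : covers x y d (scale_block s b) =
  if (coef x b, coef y b) is (Some p, Some q) then (s *+ p + d == s *+ q)%R else false.
  by case/orP: wb => wb; rewrite (covers_scale _ _ _ _ wb).
by case: (coef x b) => [p|] //; case: (coef y b) => [q|].
Qed.

(** As g = 2k + 1 is odd, the residues 0, 1, ..., k, -1, ..., -k are all the elements of Z/g, each
    once. *)
Lemma sum_half_system (e : A) :
  (e == 0%R) + \sum_(i < k) ((e == inord i.+1) + (e == - inord i.+1)%R) = 1.
Proof.
have vi (i : 'I_k) : (inord i.+1 : 'I_g) = i.+1 :> nat.
  by rewrite inordK // /g; have := ltn_ord i; rewrite -addnn; lia.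
have vN (i : 'I_k) : ((- (inord i.+1 : A))%R : 'I_g) = g - i.+1 :> nat.
  rewrite /= vi modn_small //; have := ltn_ord i; rewrite /g -addnn; lia.
have S0 (P : pred 'I_k) : (forall i, ~~ P i) -> \sum_(i < k) (P i : nat) = 0.
  by move=> H; rewrite big1 // => i _; rewrite (negPf (H i)).
have S1 (P : pred 'I_k) j : (forall i, P i = (i == j)) -> \sum_(i < k) (P i : nat) = 1.
  move=> H; rewrite (bigD1 j) //= H eqxx big1 // => i ij.
  by rewrite H (negPf ij).
have [n eE ng] : exists2 n : nat,
    forall b : A, (e == b) = (n == (b : 'I_g) :> nat) & n < g.
  by exists (e : 'I_g).
rewrite big_split /= eE /= /g in ng *.
have [n0|ne0] := eqVneq n 0.
  rewrite !S0 // => i; rewrite eE ?vN ?vi n0 //.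
  by rewrite /g; have := ltn_ord i; lia.
case: (leqP n k) => nk.
  (* Index [i] stands for the residue i + 1, so a residue n with 0 < n <= k is met at index n -
     1. *)
  have jk : n.-1 < k by lia.
  rewrite (S1 _ (Ordinal jk)) ?S0 // => i; rewrite eE ?vN ?vi.
    by have := ltn_ord i; rewrite /g; lia.
  by rewrite -val_eqE /=; lia.
(* A residue n > k is -(g - n), met at index g - n - 1 = 2k - n. *)
have jk : k.*2 - n < k by lia.
rewrite S0 ?(S1 _ (Ordinal jk)) // => i; rewrite eE ?vN ?vi.
  by rewrite -val_eqE /= /g; have := ltn_ord i; lia.
by have := ltn_ord i; lia.
Qed.

Lemma mulrn_coprime_inj c : coprime g c -> injective (fun e : A => e *+ c)%R.
Proof.
move=> cgc.
have key a b : b <= a -> a < g -> a * c = b * c %[mod g] -> a = b.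
  move=> ba ag /eqP; rewrite eqn_mod_dvd ?leq_mul2r ?ba ?orbT // -mulnBl Gauss_dvdl //.
  case: (posnP (a - b)) => [|pos]; first by lia.
  by move=> /(dvdn_leq pos); lia.
move=> e f; rewrite !Zp_mulrn => /(congr1 val) /= E; apply: (@ord_inj g).
have [le|/ltnW le] := leqP (f : 'I_g) (e : 'I_g).
  exact: key le (ltn_ord _) E.
by apply/esym/(key _ _ le (ltn_ord _)).
Qed.

(** Multiplication by [c] is a bijection of Z/g that commutes with negation, so it preserves the
    partition of [sum_half_system]. *)
Lemma sum_scaled_half_system c (d : A) : coprime g c ->
  (d == 0%R) + \sum_(i < k) ((d == inord i.+1 *+ c)%R + (d == - (inord i.+1 *+ c))%R) = 1.
Proof.
move=> cgc; have inj := mulrn_coprime_inj cgc.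
have [e ->] : exists e, d = (e *+ c)%R.
  by have [h _ hK] := injF_bij inj; exists (h d); rewrite hK.
rewrite -[RHS](sum_half_system e).
have -> : (e *+ c == 0)%R = (e == 0%R) by rewrite -[RHS](inj_eq inj) mul0rn.
congr (_ + _); apply: eq_bigr => i _.
by rewrite (inj_eq inj) -mulNrn (inj_eq inj).
Qed.

Variables (cs : seq nat) (cf : nat -> nat -> nat) (t0 : template) (ts : seq template).
Hypothesis cs_coprime : all (coprime g) cs.
Hypothesis t0_ok : simple_template u t0.
Hypothesis ts_ok : all (signed_template u cs cf) ts.
Hypothesis ts_size : size ts = k.
Hypothesis t0_class : 0 < size t0.1.

Let scaled : seq (A * template) :=
  (0%R, t0) :: [seq (inord i.+1 : A, nth t0 ts i) | i <- iota 0 k].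

Let C := flatten [seq map (map (scale_block st.1)) st.2.1 | st <- scaled].
Let Q := flatten [seq map (scale_block st.1) st.2.2 | st <- scaled].

Lemma scaled_shape st : st \in scaled -> shape_ok u st.2.
Proof.
rewrite inE => /predU1P [->|/mapP [i + ->]]; first by case/andP: t0_ok.
rewrite mem_iota => /andP [_ ik].
have its : i < size ts by rewrite ts_size.
by have /andP [] := allP ts_ok _ (mem_nth t0 its).
Qed.

(** Exactly two blocks of [t] contain both points; after scaling, one has the difference s c and the
    other -s c, where c = [cf x y]. *)
Lemma count_signed s (t : template) (x y : 'I_u) d : signed_template u cs cf t -> x != y ->
  count (covers x y d) (map (scale_block s) (blocks_of t)) =
  (d == s *+ cf x y)%R + (d == - (s *+ cf x y))%R.
Proof.
move=> /andP [sh H] nxy; rewrite count_covers_scale //.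
have /andP [_] := for_pairsP H (ltn_ord x) (ltn_ord y) nxy.
case: (joint_coefs _ _ _) => [|[p1 q1] [|[p2 q2] [|? ?]]] //= +.
have plus p : (s *+ p + d == s *+ (p + cf x y))%R = (d == s *+ cf x y)%R.
  by rewrite mulrnDr (inj_eq (addrI _)).
have minus p : (s *+ (p + cf x y) + d == s *+ p)%R = (d == - (s *+ cf x y))%R.
  by rewrite mulrnDr -addrA -[X in _ == X]addr0 (inj_eq (addrI _)) addrC addr_eq0.
by case/orP => /andP [/eqP -> /eqP ->]; rewrite plus minus addn0 // addnC.
Qed.

(** For a pair x, y, the template [t0] covers the difference 0 and the i-th signed template covers
    (i + 1) c and -(i + 1) c. The same c = [cf x y] serves all of them, so [sum_scaled_half_system]
    applies. *)
Lemma templates_4GDD :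
  exists_4GDD [:: (g, u); (size t0.1 + sumn [seq size t.1 | t <- ts], 1)].
Proof.
have EC : size C = size t0.1 + sumn [seq size t.1 | t <- ts].
  rewrite /C size_flatten /shape -map_comp /= size_map; congr (_ + sumn _).
  rewrite -map_comp -[in RHS](mkseq_nth t0 ts) /mkseq ts_size -map_comp.
  by apply: eq_map => i /=; rewrite size_map.
rewrite -EC -[X in (X, u)](card_ord g).
apply: (@development u (size C) A C Q) => //.
- by rewrite EC ltn_addr.
- move=> c b /flattenP [_ /mapP [st /scaled_shape /and3P [H _ _] ->] /mapP [c' c't ->]].
  case/mapP => b' b'c ->; apply: well_formed_scale.
  by have /allP := allP H _ c't; apply.
- move=> b /flattenP [_ /mapP [st /scaled_shape /and3P [_ H _] ->] /mapP [b' b't ->]].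
  by apply: well_formed_scale; exact: (allP H).
- move=> c x /flattenP [_ /mapP [st /scaled_shape /and3P [W _ H] ->] /mapP [c' c't ->]].
  have Wc := allP W _ c't; have P := allP H _ c't.
  rewrite count_map.
  (* The points of a block are distinct, so counting blocks through [x] amounts to counting [x] in
     the concatenated class, a permutation of 0, ..., u - 1. *)
  have -> : count (preim (scale_block st.1) (fun b => x \in map fst b)) c'
          = count_mem (val x) (map fst (flatten c')).
    elim: c' Wc {P c't} => //= b c' IH /andP [wb /IH ->].
    rewrite map_cat count_cat; congr (_ + _).
    rewrite map_fst_scale; have /and3P [_ Ub Hb] := wb.
    rewrite count_uniq_mem //; congr nat_of_bool.
    apply/mapP/idP => [[z zb ->]|xb]; last by exists (val x); rewrite ?inord_val.
    by rewrite inordK //; case/mapP: zb => p /(allP Hb) ? ->.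
  by rewrite (permP P) count_uniq_mem ?iota_uniq // mem_iota add0n ltn_ord.
- move=> x y d nxy.
  have -> : count (covers x y d) (flatten C ++ Q) =
      \sum_(st <- scaled) count (covers x y d) (map (scale_block st.1) (blocks_of st.2)).
    rewrite /C /Q; elim: scaled => [|st l IH]; first by rewrite big_nil.
    rewrite big_cons -IH /= flatten_cat -map_flatten /blocks_of map_cat !count_cat.
    exact: addnACA.
  rewrite big_cons big_map /= count_covers_scale; last by case/andP: t0_ok.
  have := ts_ok; have /andP [_ /for_pairsP /(_ (ltn_ord x) (ltn_ord y) nxy)] := t0_ok.
  case: (joint_coefs _ _ _) => [|[p q] [|? ?]] //= _ _; rewrite !mul0rn add0r addn0.
  under eq_big_seq => i.
    rewrite mem_iota => /andP [_ ik].
    have its : i < size ts by rewrite ts_size.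
    rewrite (count_signed _ _ (allP ts_ok _ (mem_nth t0 its)) nxy).
    over.
  have sumE c : coprime g c -> (d == 0%R) + \sum_(i <- iota 0 k)
      ((d == inord i.+1 *+ c)%R + (d == - (inord i.+1 *+ c))%R) = 1.
    move=> /(sum_scaled_half_system d); rewrite -(big_mkord xpredT (fun i =>
      (d == inord i.+1 *+ c)%R + (d == - (inord i.+1 *+ c))%R)).
    by rewrite /index_iota subn0.
  (* For k = 0 no signed template constrains [cf x y], but the sum is empty and c = 1 will do.
     Otherwise the first signed template shows that [cf x y] lies in [cs]. *)
  case: (posnP k) => [k0|k_gt0].
    have /sumE : coprime g 1 by rewrite coprimen1.
    by rewrite ![in iota 0 k]k0 !big_nil.
  apply: sumE; have t_ts : nth t0 ts 0 \in ts by rewrite mem_nth // ts_size.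
  have /andP [_ /for_pairsP] := allP ts_ok _ t_ts.
  move=> /(_ _ _ (ltn_ord x) (ltn_ord y) nxy) /andP [c_cs _].
  exact: (allP cs_coprime).
Qed.
End Templates.

(** * Mixing two signed templates *)

Section Interpolation.
Variables (u' k j : nat) (cs : seq nat) (cf : nat -> nat -> nat) (t0 ta tb : template).

Lemma interpolated_4GDD :
  all (coprime k.*2.+1) cs -> j <= k -> 0 < size t0.1 ->
  simple_template u'.+1 t0 ->
  signed_template u'.+1 cs cf ta -> signed_template u'.+1 cs cf tb ->
  exists_4GDD [:: (k.*2.+1, u'.+1);
                  (size t0.1 + ((k - j) * size ta.1 + j * size tb.1), 1)].
Proof.
move=> Hcs jk t0_gt0 H0 Ha Hb.
have -> : (k - j) * size ta.1 + j * size tb.1 =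
    sumn [seq size t.1 | t <- nseq (k - j) ta ++ nseq j tb].
  by rewrite map_cat !map_nseq sumn_cat !sumn_nseq ![_ * size _]mulnC.
apply: (templates_4GDD (cs := cs) (cf := cf)) => //.
  by rewrite all_cat !all_nseq Ha Hb !orbT.
by rewrite size_cat !size_nseq subnK.
Qed.
End Interpolation.

(** * Templates with a cyclic symmetry *)

(* Points come in rows of length [p]; the last three points of the design
   [simple33_10], numbered from [N], form a shorter row. *)
Definition rotate_point (p N i x : nat) :=
  if x < N then x %/ p * p + (x %% p + i) %% p else N + (x - N + i) %% 3.

Definition rotate_block (p N i : nat) (b : base_block) : base_block :=
  [seq (rotate_point p N i xc.1, xc.2) | xc <- b].

(* An entry [(l, n, c)] stands for the [l] classes obtained by rotating by
   [0, ..., l - 1] the union of the [n] rotations of [c] by multiples of [l]. *)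
Definition develop (p N : nat) (cls : seq (nat * nat * seq base_block))
    (quads : seq (nat * seq base_block)) : template :=
  (flatten [seq [seq flatten [seq [seq rotate_block p N (i + e.1.1 * j) b | b <- e.2]
                             | j <- iota 0 e.1.2]
                | i <- iota 0 e.1.1]
           | e <- cls],
   flatten [seq flatten [seq [seq rotate_block p N i b | i <- iota 0 e.1] | b <- e.2]
           | e <- quads]).

(** The sum of the two truncated differences is |p - q|. The default 0 is in none of the lists of
    allowed values used below, so an uncovered pair would be rejected. *)
Definition coef_distance (t : template) : nat -> nat -> nat :=
  let bs := blocks_of t in
  fun x y => if joint_coefs bs x y is (p, q) :: _ then (p - q) + (q - p) else 0.

(** * Explicit templates *)

(* The templates below were found by a computer search, under the assumption of
   a cyclic symmetry.  Only the differences of the coefficients in a block matter,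
   so they are normalised to be natural numbers. *)

Definition simple21_4 : template :=
  develop 7 21
    [:: (1, 7, [:: [:: (0, 0); (11, 0); (20, 0)]]);
        (1, 7, [:: [:: (0, 0); (8, 0); (19, 0)]]);
        (1, 7, [:: [:: (0, 0); (9, 0); (17, 0)]]);
        (1, 7, [:: [:: (0, 0); (7, 0); (14, 0)]])]
    [:: (7,
        [:: [:: (0, 0); (10, 0); (12, 0); (13, 0)];
            [:: (0, 0); (1, 0); (5, 0); (16, 0)];
            [:: (7, 0); (17, 0); (19, 0); (20, 0)]])].

(** A Kirkman triple system of order 21: (21 - 1)/2 classes and no quadruples. *)
Definition simple21_10 : template :=
  develop 7 21
    [:: (1, 7, [:: [:: (0, 0); (11, 0); (20, 0)]]);
        (1, 7, [:: [:: (0, 0); (12, 0); (16, 0)]]);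
        (1, 7, [:: [:: (0, 0); (7, 0); (15, 0)]]);
        (7, 1,
        [:: [:: (14, 0); (15, 0); (17, 0)];
            [:: (13, 0); (8, 0); (18, 0)];
            [:: (9, 0); (10, 0); (16, 0)];
            [:: (5, 0); (7, 0); (11, 0)];
            [:: (2, 0); (4, 0); (12, 0)];
            [:: (3, 0); (6, 0); (20, 0)];
            [:: (0, 0); (1, 0); (19, 0)]])]
    [::].

Definition signed21_2 : template :=
  develop 7 21
    [:: (1, 7, [:: [:: (0, 3); (9, 0); (20, 1)]]);
        (1, 7, [:: [:: (0, 2); (8, 1); (19, 0)]])]
    [:: (7,
        [:: [:: (0, 3); (1, 1); (5, 2); (16, 0)];
            [:: (7, 0); (17, 1); (19, 2); (20, 4)];
            [:: (0, 0); (10, 3); (11, 1); (13, 2)];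
            [:: (0, 0); (8, 1); (9, 3); (17, 4)];
            [:: (0, 4); (7, 1); (14, 3); (17, 0)];
            [:: (0, 1); (2, 0); (7, 4); (14, 2)];
            [:: (0, 0); (3, 1); (16, 3); (18, 2)];
            [:: (0, 2); (1, 4); (11, 1); (13, 0)];
            [:: (7, 3); (10, 4); (15, 2); (16, 0)]])].

Definition signed21_8 : template :=
  develop 7 21
    [:: (1, 7, [:: [:: (0, 2); (11, 3); (20, 0)]]);
        (1, 7, [:: [:: (0, 2); (8, 1); (19, 0)]]);
        (1, 7, [:: [:: (0, 4); (9, 1); (17, 0)]]);
        (1, 7, [:: [:: (0, 0); (8, 1); (19, 2)]]);
        (1, 7, [:: [:: (0, 0); (7, 3); (14, 1)]]);
        (1, 7, [:: [:: (0, 3); (7, 0); (14, 2)]]);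
        (1, 7, [:: [:: (0, 0); (9, 3); (17, 4)]]);
        (1, 7, [:: [:: (0, 1); (11, 0); (20, 3)]])]
    [:: (7,
        [:: [:: (0, 0); (10, 3); (12, 4); (13, 2)];
            [:: (0, 3); (1, 1); (5, 2); (16, 0)];
            [:: (7, 0); (17, 1); (19, 2); (20, 4)];
            [:: (0, 0); (1, 2); (5, 1); (16, 3)];
            [:: (0, 4); (10, 1); (12, 0); (13, 2)];
            [:: (7, 4); (17, 3); (19, 2); (20, 0)]])].

(** Every pair is covered twice by triples alone, which gives the largest possible number of
    classes, 21 - 1. *)
Definition signed21_20 : template :=
  develop 7 21
    [:: (1, 7, [:: [:: (0, 0); (11, 1); (16, 3)]]);
        (1, 7, [:: [:: (0, 0); (12, 4); (19, 2)]]);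
        (1, 7, [:: [:: (0, 0); (7, 3); (18, 2)]]);
        (1, 7, [:: [:: (0, 0); (10, 3); (20, 2)]]);
        (1, 7, [:: [:: (0, 3); (11, 2); (16, 0)]]);
        (1, 7, [:: [:: (0, 3); (7, 0); (18, 1)]]);
        (7, 1,
        [:: [:: (0, 4); (12, 0); (19, 2)];
            [:: (3, 2); (4, 0); (6, 1)];
            [:: (5, 3); (7, 0); (20, 4)];
            [:: (1, 0); (9, 1); (18, 4)];
            [:: (2, 2); (8, 0); (16, 1)];
            [:: (10, 2); (11, 0); (13, 1)];
            [:: (14, 0); (15, 2); (17, 3)]]);
        (7, 1,
        [:: [:: (0, 4); (8, 3); (17, 0)];
            [:: (3, 3); (13, 0); (16, 1)];
            [:: (4, 0); (10, 2); (18, 1)];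
            [:: (5, 1); (7, 4); (20, 0)];
            [:: (1, 0); (2, 2); (6, 1)];
            [:: (14, 2); (15, 0); (19, 3)];
            [:: (11, 0); (12, 2); (9, 1)]])]
    [::].

(** Short orbits occur: {0, 4, 8} is fixed by rotation by 4, and {0, 6, 12, 18} and its images by
    rotation by 6. *)
Definition simple24_1 : template :=
  develop 12 24
    [:: (1, 4,
        [:: [:: (0, 0); (4, 0); (8, 0)];
            [:: (12, 0); (16, 0); (20, 0)]])]
    [:: (6, [:: [:: (0, 0); (6, 0); (12, 0); (18, 0)]]);
        (12,
        [:: [:: (0, 0); (1, 0); (3, 0); (14, 0)];
            [:: (0, 0); (5, 0); (20, 0); (21, 0)];
            [:: (0, 0); (17, 0); (19, 0); (22, 0)]])].

Definition simple24_4 : template :=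
  develop 12 24
    [:: (1, 4,
        [:: [:: (0, 0); (4, 0); (8, 0)];
            [:: (12, 0); (16, 0); (20, 0)]]);
        (3, 4,
        [:: [:: (0, 0); (5, 0); (21, 0)];
            [:: (1, 0); (19, 0); (20, 0)]])]
    [:: (3,
        [:: [:: (0, 0); (3, 0); (6, 0); (9, 0)];
            [:: (12, 0); (15, 0); (18, 0); (21, 0)]]);
        (12,
        [:: [:: (0, 0); (1, 0); (12, 0); (14, 0)];
            [:: (0, 0); (2, 0); (17, 0); (22, 0)]])].

Definition simple24_7 : template :=
  develop 6 24
    [:: (1, 2,
        [:: [:: (0, 0); (2, 0); (4, 0)];
            [:: (6, 0); (8, 0); (10, 0)];
            [:: (12, 0); (14, 0); (16, 0)];
            [:: (18, 0); (20, 0); (22, 0)]]);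
        (3, 2,
        [:: [:: (0, 0); (9, 0); (14, 0)];
            [:: (8, 0); (16, 0); (21, 0)];
            [:: (1, 0); (2, 0); (7, 0)];
            [:: (12, 0); (19, 0); (20, 0)]]);
        (3, 2,
        [:: [:: (0, 0); (15, 0); (18, 0)];
            [:: (2, 0); (9, 0); (23, 0)];
            [:: (7, 0); (8, 0); (19, 0)];
            [:: (1, 0); (13, 0); (14, 0)]])]
    [:: (3,
        [:: [:: (0, 0); (3, 0); (19, 0); (22, 0)];
            [:: (6, 0); (9, 0); (13, 0); (16, 0)]]);
        (6,
        [:: [:: (0, 0); (8, 0); (17, 0); (23, 0)];
            [:: (0, 0); (10, 0); (16, 0); (20, 0)]])].

Definition simple24_10 : template :=
  develop 12 24
    [:: (1, 4,
        [:: [:: (0, 0); (4, 0); (8, 0)];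
            [:: (12, 0); (16, 0); (20, 0)]]);
        (3, 4,
        [:: [:: (0, 0); (1, 0); (12, 0)];
            [:: (2, 0); (16, 0); (17, 0)]]);
        (3, 4,
        [:: [:: (0, 0); (2, 0); (18, 0)];
            [:: (1, 0); (20, 0); (22, 0)]]);
        (3, 4,
        [:: [:: (0, 0); (5, 0); (13, 0)];
            [:: (1, 0); (18, 0); (23, 0)]])]
    [:: (3,
        [:: [:: (0, 0); (3, 0); (6, 0); (9, 0)];
            [:: (12, 0); (15, 0); (18, 0); (21, 0)]])].

(** Rotation by 4 fixes the triples of the first two classes as sets but not their coefficients.
    Only four rotations are taken, and the second class reverses the coefficients of the first. *)
Definition signed24_2 : template :=
  develop 12 24
    [:: (1, 4,
        [:: [:: (0, 0); (4, 1); (8, 2)];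
            [:: (12, 0); (16, 1); (20, 2)]]);
        (1, 4,
        [:: [:: (0, 2); (4, 1); (8, 0)];
            [:: (12, 2); (16, 1); (20, 0)]])]
    [:: (12,
        [:: [:: (0, 0); (1, 3); (6, 5); (20, 2)];
            [:: (0, 3); (15, 0); (16, 2); (22, 1)];
            [:: (0, 3); (1, 0); (10, 1); (23, 2)];
            [:: (0, 2); (13, 1); (20, 0); (23, 3)];
            [:: (0, 2); (5, 0); (17, 1); (19, 3)];
            [:: (0, 2); (2, 0); (17, 3); (18, 1)];
            [:: (0, 1); (3, 2); (12, 0); (21, 3)]])].

Definition signed24_14 : template :=
  develop 12 24
    [:: (1, 4,
        [:: [:: (0, 0); (4, 1); (8, 2)];
            [:: (12, 0); (16, 1); (20, 2)]]);
        (1, 4,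
        [:: [:: (0, 2); (4, 1); (8, 0)];
            [:: (12, 2); (16, 1); (20, 0)]]);
        (12, 1,
        [:: [:: (0, 1); (12, 2); (23, 0)];
            [:: (1, 0); (15, 3); (21, 2)];
            [:: (7, 3); (22, 0); (17, 1)];
            [:: (4, 2); (5, 5); (11, 0)];
            [:: (3, 0); (16, 1); (18, 3)];
            [:: (8, 2); (10, 0); (14, 1)];
            [:: (9, 2); (2, 0); (13, 1)];
            [:: (6, 3); (19, 2); (20, 0)]])]
    [:: (12,
        [:: [:: (0, 1); (17, 2); (19, 0); (22, 3)];
            [:: (0, 1); (3, 2); (12, 0); (21, 3)];
            [:: (0, 3); (1, 0); (3, 2); (20, 1)]])].

Definition signed24_23 : template :=
  develop 12 24
    [:: (1, 4,
        [:: [:: (0, 0); (4, 1); (8, 2)];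
            [:: (12, 0); (16, 1); (20, 2)]]);
        (1, 4,
        [:: [:: (0, 2); (4, 1); (8, 0)];
            [:: (12, 2); (16, 1); (20, 0)]]);
        (3, 4,
        [:: [:: (0, 0); (14, 3); (16, 1)];
            [:: (1, 0); (2, 3); (21, 2)]]);
        (3, 4,
        [:: [:: (0, 3); (15, 0); (22, 1)];
            [:: (2, 0); (4, 2); (17, 3)]]);
        (3, 4,
        [:: [:: (0, 0); (5, 2); (17, 1)];
            [:: (1, 1); (13, 2); (12, 0)]]);
        (12, 1,
        [:: [:: (0, 3); (14, 0); (16, 2)];
            [:: (7, 2); (9, 0); (20, 1)];
            [:: (3, 3); (4, 0); (10, 5)];
            [:: (1, 1); (19, 0); (22, 3)];
            [:: (5, 2); (8, 1); (13, 0)];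
            [:: (17, 2); (18, 0); (23, 1)];
            [:: (11, 0); (2, 1); (21, 2)];
            [:: (6, 2); (12, 3); (15, 0)]])]
    [::].

Definition simple33_4 : template :=
  develop 11 33
    [:: (1, 11, [:: [:: (0, 0); (18, 0); (22, 0)]]);
        (1, 11, [:: [:: (0, 0); (16, 0); (32, 0)]]);
        (1, 11, [:: [:: (0, 0); (14, 0); (27, 0)]]);
        (1, 11, [:: [:: (0, 0); (17, 0); (23, 0)]])]
    [:: (11,
        [:: [:: (0, 0); (2, 0); (5, 0); (15, 0)];
            [:: (0, 0); (1, 0); (12, 0); (20, 0)];
            [:: (0, 0); (25, 0); (28, 0); (29, 0)];
            [:: (0, 0); (4, 0); (24, 0); (30, 0)];
            [:: (11, 0); (12, 0); (22, 0); (31, 0)];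
            [:: (11, 0); (13, 0); (18, 0); (25, 0)]])].

Definition simple33_10 : template :=
  develop 6 30
    [:: (1, 1,
        [:: [:: (0, 0); (2, 0); (4, 0)];
            [:: (1, 0); (3, 0); (5, 0)];
            [:: (6, 0); (8, 0); (10, 0)];
            [:: (7, 0); (9, 0); (11, 0)];
            [:: (12, 0); (14, 0); (16, 0)];
            [:: (13, 0); (15, 0); (17, 0)];
            [:: (18, 0); (20, 0); (22, 0)];
            [:: (19, 0); (21, 0); (23, 0)];
            [:: (24, 0); (26, 0); (28, 0)];
            [:: (25, 0); (27, 0); (29, 0)];
            [:: (30, 0); (31, 0); (32, 0)]]);
        (3, 1,
        [:: [:: (14, 0); (17, 0); (30, 0)];
            [:: (25, 0); (28, 0); (31, 0)];
            [:: (18, 0); (21, 0); (32, 0)];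
            [:: (8, 0); (15, 0); (20, 0)];
            [:: (2, 0); (13, 0); (22, 0)];
            [:: (0, 0); (6, 0); (24, 0)];
            [:: (1, 0); (10, 0); (26, 0)];
            [:: (11, 0); (12, 0); (23, 0)];
            [:: (5, 0); (16, 0); (19, 0)];
            [:: (3, 0); (9, 0); (27, 0)];
            [:: (4, 0); (7, 0); (29, 0)]]);
        (6, 1,
        [:: [:: (0, 0); (23, 0); (26, 0)];
            [:: (8, 0); (18, 0); (19, 0)];
            [:: (4, 0); (20, 0); (25, 0)];
            [:: (6, 0); (21, 0); (29, 0)];
            [:: (11, 0); (13, 0); (14, 0)];
            [:: (5, 0); (15, 0); (27, 0)];
            [:: (7, 0); (12, 0); (28, 0)];
            [:: (3, 0); (10, 0); (16, 0)];
            [:: (9, 0); (22, 0); (32, 0)];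
            [:: (1, 0); (2, 0); (30, 0)];
            [:: (17, 0); (24, 0); (31, 0)]])]
    [:: (3, [:: [:: (0, 0); (3, 0); (8, 0); (11, 0)]]);
        (6,
        [:: [:: (0, 0); (15, 0); (21, 0); (30, 0)];
            [:: (6, 0); (7, 0); (26, 0); (31, 0)];
            [:: (0, 0); (12, 0); (19, 0); (29, 0)];
            [:: (12, 0); (20, 0); (26, 0); (27, 0)];
            [:: (0, 0); (10, 0); (14, 0); (18, 0)]])].

(** A Kirkman triple system of order 33. *)
Definition simple33_16 : template :=
  develop 11 33
    [:: (1, 11, [:: [:: (0, 0); (21, 0); (23, 0)]]);
        (1, 11, [:: [:: (0, 0); (13, 0); (24, 0)]]);
        (1, 11, [:: [:: (0, 0); (15, 0); (30, 0)]]);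
        (1, 11, [:: [:: (0, 0); (17, 0); (27, 0)]]);
        (1, 11, [:: [:: (0, 0); (14, 0); (32, 0)]]);
        (11, 1,
        [:: [:: (22, 0); (23, 0); (27, 0)];
            [:: (5, 0); (6, 0); (8, 0)];
            [:: (10, 0); (28, 0); (30, 0)];
            [:: (7, 0); (32, 0); (24, 0)];
            [:: (0, 0); (4, 0); (26, 0)];
            [:: (9, 0); (3, 0); (21, 0)];
            [:: (1, 0); (12, 0); (20, 0)];
            [:: (2, 0); (18, 0); (11, 0)];
            [:: (16, 0); (17, 0); (25, 0)];
            [:: (14, 0); (19, 0); (31, 0)];
            [:: (13, 0); (15, 0); (29, 0)]])]
    [::].

Definition signed33_2 : template :=
  develop 11 33
    [:: (1, 11, [:: [:: (0, 0); (15, 1); (31, 4)]]);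
        (1, 11, [:: [:: (0, 1); (12, 0); (27, 3)]])]
    [:: (11,
        [:: [:: (11, 0); (12, 4); (22, 1); (31, 3)];
            [:: (0, 3); (18, 4); (19, 0); (27, 1)];
            [:: (0, 2); (12, 3); (15, 1); (28, 0)];
            [:: (0, 1); (1, 3); (18, 0); (21, 2)];
            [:: (0, 4); (14, 3); (24, 6); (31, 0)];
            [:: (0, 2); (4, 4); (14, 3); (29, 0)];
            [:: (0, 0); (17, 3); (23, 6); (28, 2)];
            [:: (0, 2); (1, 0); (20, 3); (22, 4)];
            [:: (0, 2); (4, 0); (29, 4); (30, 8)];
            [:: (0, 8); (22, 6); (23, 2); (26, 0)];
            [:: (0, 6); (24, 4); (30, 0); (32, 2)];
            [:: (11, 12); (13, 0); (18, 8); (25, 6)];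
            [:: (11, 0); (13, 12); (18, 4); (25, 6)];
            [:: (0, 3); (2, 2); (8, 0); (13, 1)];
            [:: (0, 0); (2, 1); (8, 3); (13, 2)]])].

Definition signed33_20 : template :=
  develop 11 33
    [:: (1, 11, [:: [:: (0, 4); (17, 1); (25, 0)]]);
        (1, 11, [:: [:: (0, 2); (18, 3); (24, 0)]]);
        (1, 11, [:: [:: (0, 1); (11, 0); (28, 3)]]);
        (1, 11, [:: [:: (0, 4); (21, 3); (31, 0)]]);
        (1, 11, [:: [:: (0, 0); (16, 1); (27, 2)]]);
        (1, 11, [:: [:: (0, 2); (14, 3); (29, 0)]]);
        (1, 11, [:: [:: (0, 0); (17, 3); (25, 4)]]);
        (1, 11, [:: [:: (0, 1); (20, 0); (29, 3)]]);
        (1, 11, [:: [:: (0, 0); (13, 2); (31, 4)]]);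
        (11, 1,
        [:: [:: (0, 2); (4, 0); (16, 1)];
            [:: (1, 2); (2, 4); (23, 0)];
            [:: (20, 3); (25, 6); (29, 0)];
            [:: (7, 1); (19, 0); (11, 2)];
            [:: (5, 6); (9, 8); (24, 0)];
            [:: (10, 6); (22, 0); (27, 4)];
            [:: (21, 1); (32, 0); (31, 4)];
            [:: (15, 0); (28, 1); (30, 3)];
            [:: (6, 3); (8, 2); (3, 0)];
            [:: (17, 4); (18, 0); (13, 8)];
            [:: (12, 0); (14, 12); (26, 6)]])]
    [:: (11,
        [:: [:: (0, 2); (11, 3); (14, 1); (27, 0)];
            [:: (0, 3); (1, 1); (19, 0); (20, 4)];
            [:: (0, 0); (22, 2); (23, 6); (26, 8)];
            [:: (0, 0); (24, 2); (30, 6); (32, 4)];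
            [:: (0, 2); (2, 3); (5, 0); (15, 1)];
            [:: (11, 12); (13, 0); (18, 8); (25, 6)]])].

Definition signed33_32 : template :=
  develop 11 33
    [:: (1, 11, [:: [:: (0, 2); (14, 3); (24, 0)]]);
        (1, 11, [:: [:: (0, 0); (13, 2); (31, 4)]]);
        (1, 11, [:: [:: (0, 2); (20, 1); (22, 0)]]);
        (1, 11, [:: [:: (0, 1); (15, 0); (24, 3)]]);
        (1, 11, [:: [:: (0, 1); (12, 0); (27, 3)]]);
        (1, 11, [:: [:: (0, 1); (16, 0); (22, 3)]]);
        (1, 11, [:: [:: (0, 0); (15, 1); (28, 2)]]);
        (1, 11, [:: [:: (0, 2); (12, 3); (27, 0)]]);
        (1, 11, [:: [:: (0, 4); (13, 2); (31, 0)]]);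
        (1, 11, [:: [:: (0, 3); (17, 0); (28, 1)]]);
        (11, 1,
        [:: [:: (0, 3); (11, 2); (19, 0)];
            [:: (14, 3); (30, 6); (23, 0)];
            [:: (21, 1); (32, 0); (29, 2)];
            [:: (13, 12); (15, 0); (27, 6)];
            [:: (3, 0); (22, 6); (24, 4)];
            [:: (4, 3); (6, 2); (1, 0)];
            [:: (16, 4); (17, 8); (12, 0)];
            [:: (20, 3); (25, 0); (28, 2)];
            [:: (5, 0); (7, 1); (2, 3)];
            [:: (9, 2); (10, 0); (18, 3)];
            [:: (8, 0); (31, 6); (26, 2)]]);
        (11, 1,
        [:: [:: (0, 1); (18, 2); (21, 0)];
            [:: (8, 0); (9, 2); (14, 3)];
            [:: (17, 0); (19, 12); (31, 6)];
            [:: (4, 6); (27, 0); (29, 2)];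
            [:: (1, 0); (5, 2); (12, 1)];
            [:: (15, 4); (16, 0); (11, 8)];
            [:: (10, 2); (3, 0); (13, 1)];
            [:: (6, 6); (24, 4); (25, 0)];
            [:: (20, 3); (26, 0); (30, 6)];
            [:: (2, 8); (28, 0); (23, 4)];
            [:: (7, 0); (32, 4); (22, 8)]])]
    [::].

(** * Verification of the templates *)

(** The entries for 21 and 33 points divide 24 and those for 24 points divide 30. The entry 5 is why
    g must also be prime to 5 when u = 24. *)
Definition units21 := [:: 1; 2; 3; 4].
Definition units24 := [:: 1; 2; 3; 5].
Definition units33 := [:: 1; 2; 3; 4; 6; 8; 12].

Lemma simple21_4_ok : simple_template 21 simple21_4.
Proof. by vm_compute. Qed.
Lemma simple21_4_size : size simple21_4.1 = 4.
Proof. by vm_compute. Qed.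

Lemma simple21_10_ok : simple_template 21 simple21_10.
Proof. by vm_compute. Qed.
Lemma simple21_10_size : size simple21_10.1 = 10.
Proof. by vm_compute. Qed.

Lemma signed21_2_ok :
  signed_template 21 units21 (coef_distance signed21_2) signed21_2.
Proof. by vm_compute. Qed.
Lemma signed21_2_size : size signed21_2.1 = 2.
Proof. by vm_compute. Qed.

Lemma signed21_8_ok :
  signed_template 21 units21 (coef_distance signed21_2) signed21_8.
Proof. by vm_compute. Qed.
Lemma signed21_8_size : size signed21_8.1 = 8.
Proof. by vm_compute. Qed.

Lemma signed21_20_ok :
  signed_template 21 units21 (coef_distance signed21_2) signed21_20.
Proof. by vm_compute. Qed.
Lemma signed21_20_size : size signed21_20.1 = 20.
Proof. by vm_compute. Qed.

Lemma simple24_1_ok : simple_template 24 simple24_1.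
Proof. by vm_compute. Qed.
Lemma simple24_1_size : size simple24_1.1 = 1.
Proof. by vm_compute. Qed.

Lemma simple24_4_ok : simple_template 24 simple24_4.
Proof. by vm_compute. Qed.
Lemma simple24_4_size : size simple24_4.1 = 4.
Proof. by vm_compute. Qed.

Lemma simple24_7_ok : simple_template 24 simple24_7.
Proof. by vm_compute. Qed.
Lemma simple24_7_size : size simple24_7.1 = 7.
Proof. by vm_compute. Qed.

Lemma simple24_10_ok : simple_template 24 simple24_10.
Proof. by vm_compute. Qed.
Lemma simple24_10_size : size simple24_10.1 = 10.
Proof. by vm_compute. Qed.

Lemma signed24_2_ok :
  signed_template 24 units24 (coef_distance signed24_2) signed24_2.
Proof. by vm_compute. Qed.
Lemma signed24_2_size : size signed24_2.1 = 2.
Proof. by vm_compute. Qed.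

Lemma signed24_14_ok :
  signed_template 24 units24 (coef_distance signed24_2) signed24_14.
Proof. by vm_compute. Qed.
Lemma signed24_14_size : size signed24_14.1 = 14.
Proof. by vm_compute. Qed.

Lemma signed24_23_ok :
  signed_template 24 units24 (coef_distance signed24_2) signed24_23.
Proof. by vm_compute. Qed.
Lemma signed24_23_size : size signed24_23.1 = 23.
Proof. by vm_compute. Qed.

Lemma simple33_4_ok : simple_template 33 simple33_4.
Proof. by vm_compute. Qed.
Lemma simple33_4_size : size simple33_4.1 = 4.
Proof. by vm_compute. Qed.

Lemma simple33_10_ok : simple_template 33 simple33_10.
Proof. by vm_compute. Qed.
Lemma simple33_10_size : size simple33_10.1 = 10.
Proof. by vm_compute. Qed.

Lemma simple33_16_ok : simple_template 33 simple33_16.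
Proof. by vm_compute. Qed.
Lemma simple33_16_size : size simple33_16.1 = 16.
Proof. by vm_compute. Qed.

Lemma signed33_2_ok :
  signed_template 33 units33 (coef_distance signed33_2) signed33_2.
Proof. by vm_compute. Qed.
Lemma signed33_2_size : size signed33_2.1 = 2.
Proof. by vm_compute. Qed.

Lemma signed33_20_ok :
  signed_template 33 units33 (coef_distance signed33_2) signed33_20.
Proof. by vm_compute. Qed.
Lemma signed33_20_size : size signed33_20.1 = 20.
Proof. by vm_compute. Qed.

Lemma signed33_32_ok :
  signed_template 33 units33 (coef_distance signed33_2) signed33_32.
Proof. by vm_compute. Qed.
Lemma signed33_32_size : size signed33_32.1 = 32.
Proof. by vm_compute. Qed.

(** * Choosing the templates *)

Lemma coprime_all_dvdn n N (cs : seq nat) :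
  coprime n N -> all (dvdn^~ N) cs -> all (coprime n) cs.
Proof. by move=> cop /allP H; apply/allP => c /H /coprime_dvdr; apply. Qed.

Lemma coprime_6 k : k %% 3 != 1 -> coprime k.*2.+1 6.
Proof.
move=> k3; rewrite -[6]/(2 * 3) coprimeMr !(coprime_sym _ 2) !(coprime_sym _ 3).
by rewrite !prime_coprime //; lia.
Qed.

Lemma coprime_24 k : k %% 3 != 1 -> coprime k.*2.+1 24.
Proof.
move=> /coprime_6 c6; apply: coprime_dvdr (_ : 24 %| 6 ^ 3) _ => //.
exact: coprimeXr.
Qed.

Lemma coprime_30 k : k %% 3 != 1 -> k %% 5 = 0 -> coprime k.*2.+1 30.
Proof.
move=> /coprime_6 c6 k5; rewrite -[30]/(6 * 5) coprimeMr c6 coprime_sym.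
by rewrite prime_coprime //; lia.
Qed.

(** Replacing 2 classes by 8 raises m by 6, which suffices up to r = k. Beyond that, replacing 8 by
    20 raises m by 12, and [t0] with 4 or 10 classes settles the parity. The bound on r says m <=
    10g. *)
Lemma exists_4GDD_21 k r : k %% 3 != 1 -> r <= 3 * k + 1 ->
  exists_4GDD [:: (k.*2.+1, 21); (4 + 2 * k + 6 * r, 1)].
Proof.
move=> k3 rk; have cop : all (coprime k.*2.+1) units21.
  exact: coprime_all_dvdn (coprime_24 k3) _.
have [rk'|rk'] := leqP r k.
  have := interpolated_4GDD cop rk' _ simple21_4_ok signed21_2_ok signed21_8_ok.
  rewrite simple21_4_size signed21_2_size signed21_8_size => /(_ isT).
  by have -> : 4 + ((k - r) * 2 + r * 8) = 4 + 2 * k + 6 * r by lia.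
pose j := (r - k)./2; have jk : j <= k by rewrite /j; lia.
have [odd_r|even_r] := boolP (odd (r - k)).
  have := interpolated_4GDD cop jk _ simple21_10_ok signed21_8_ok signed21_20_ok.
  rewrite simple21_10_size signed21_8_size signed21_20_size => /(_ isT).
  by have -> : 10 + ((k - j) * 8 + j * 20) = 4 + 2 * k + 6 * r by rewrite /j; lia.
have := interpolated_4GDD cop jk _ simple21_4_ok signed21_8_ok signed21_20_ok.
rewrite simple21_4_size signed21_8_size signed21_20_size => /(_ isT).
by have -> : 4 + ((k - j) * 8 + j * 20) = 4 + 2 * k + 6 * r by rewrite /j; lia.
Qed.

(** The steps are now 18, from 2 to 20 classes, and then 12, from 20 to 32; [t0] with 4, 10 or 16
    classes fills the gaps. The bound on r says m <= 16g. *)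
Lemma exists_4GDD_33 k r : k %% 3 != 1 -> r <= 5 * k + 2 ->
  exists_4GDD [:: (k.*2.+1, 33); (4 + 2 * k + 6 * r, 1)].
Proof.
move=> k3 rk; have cop : all (coprime k.*2.+1) units33.
  exact: coprime_all_dvdn (coprime_24 k3) _.
have low j e t : j <= k -> size t.1 = 4 + 6 * e -> simple_template 33 t ->
    r = 3 * j + e -> exists_4GDD [:: (k.*2.+1, 33); (4 + 2 * k + 6 * r, 1)].
  move=> jk st ok_t E; have := interpolated_4GDD cop jk _ ok_t signed33_2_ok signed33_20_ok.
  rewrite st signed33_2_size signed33_20_size => /(_ isT).
  by have -> : 4 + 6 * e + ((k - j) * 2 + j * 20) = 4 + 2 * k + 6 * r by lia.
have high j e t : j <= k -> size t.1 = 4 + 6 * e -> simple_template 33 t ->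
    r = 3 * k + 2 * j + e -> exists_4GDD [:: (k.*2.+1, 33); (4 + 2 * k + 6 * r, 1)].
  move=> jk st ok_t E; have := interpolated_4GDD cop jk _ ok_t signed33_20_ok signed33_32_ok.
  rewrite st signed33_20_size signed33_32_size => /(_ isT).
  by have -> : 4 + 6 * e + ((k - j) * 20 + j * 32) = 4 + 2 * k + 6 * r by lia.
have [rk'|rk'] := leqP r (3 * k + 2).
  have rE := divn_eq r 3; have jk : r %/ 3 <= k by lia.
  have: r %% 3 < 3 by rewrite ltn_mod.
  case E: (r %% 3) => [|[|[|]]] // _.
  - by apply: (low _ 0 _ jk simple33_4_size simple33_4_ok); lia.
  - by apply: (low _ 1 _ jk simple33_10_size simple33_10_ok); lia.
  - by apply: (low _ 2 _ jk simple33_16_size simple33_16_ok); lia.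
pose j := (r - 3 * k)./2; have [jk|jk] := leqP j k.
  have [odd_r|even_r] := boolP (odd (r - 3 * k)).
    by apply: (high _ 1 _ jk simple33_10_size simple33_10_ok); rewrite /j; lia.
  by apply: (high _ 0 _ jk simple33_4_size simple33_4_ok); rewrite /j; lia.
(* Here j > k forces r = 5k + 2, the largest m: every template used consists of triples only. *)
by apply: (high _ 2 _ (leqnn k) simple33_16_size simple33_16_ok); move: jk; rewrite /j; lia.
Qed.

(** The steps are 12, from 2 to 14 classes, and then 9, from 14 to 23; [t0] has 1, 4, 7 or 10
    classes. The bound on r is 5m <= 56g - 6. *)
Lemma exists_4GDD_24 k r : k %% 3 != 1 -> k %% 5 = 0 -> 15 * r <= 102 * k + 45 ->
  exists_4GDD [:: (k.*2.+1, 24); (1 + 2 * k + 3 * r, 1)].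
Proof.
move=> k3 k5 rk; have cop : all (coprime k.*2.+1) units24.
  exact: coprime_all_dvdn (coprime_30 k3 k5) _.
have low j e t : j <= k -> size t.1 = 1 + 3 * e -> simple_template 24 t ->
    r = 4 * j + e -> exists_4GDD [:: (k.*2.+1, 24); (1 + 2 * k + 3 * r, 1)].
  move=> jk st ok_t E; have := interpolated_4GDD cop jk _ ok_t signed24_2_ok signed24_14_ok.
  rewrite st signed24_2_size signed24_14_size => /(_ isT).
  by have -> : 1 + 3 * e + ((k - j) * 2 + j * 14) = 1 + 2 * k + 3 * r by lia.
have high j e t : j <= k -> size t.1 = 1 + 3 * e -> simple_template 24 t ->
    r = 4 * k + 3 * j + e -> exists_4GDD [:: (k.*2.+1, 24); (1 + 2 * k + 3 * r, 1)].
  move=> jk st ok_t E; have := interpolated_4GDD cop jk _ ok_t signed24_14_ok signed24_23_ok.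
  rewrite st signed24_14_size signed24_23_size => /(_ isT).
  by have -> : 1 + 3 * e + ((k - j) * 14 + j * 23) = 1 + 2 * k + 3 * r by lia.
have [rk'|rk'] := leqP r (4 * k + 3).
  have rE := divn_eq r 4; have jk : r %/ 4 <= k by lia.
  have: r %% 4 < 4 by rewrite ltn_mod.
  case E: (r %% 4) => [|[|[|[|]]]] // _.
  - by apply: (low _ 0 _ jk simple24_1_size simple24_1_ok); lia.
  - by apply: (low _ 1 _ jk simple24_4_size simple24_4_ok); lia.
  - by apply: (low _ 2 _ jk simple24_7_size simple24_7_ok); lia.
  - by apply: (low _ 3 _ jk simple24_10_size simple24_10_ok); lia.
(* Since r > 4k + 3 excludes k = 0 and 5 divides k, k >= 5; then q <= 2.8k + 3 <= 3k + 2. *)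
pose q := r - 4 * k; have qE := divn_eq q 3; have jk : q %/ 3 <= k by rewrite /q; lia.
have: q %% 3 < 3 by rewrite ltn_mod.
case E: (q %% 3) => [|[|[|]]] // _.
- by apply: (high _ 0 _ jk simple24_1_size simple24_1_ok); move: qE; rewrite E /q; lia.
- by apply: (high _ 1 _ jk simple24_4_size simple24_4_ok); move: qE; rewrite E /q; lia.
- by apply: (high _ 2 _ jk simple24_7_size simple24_7_ok); move: qE; rewrite E /q; lia.
Qed.

Theorem theorem4p5 :
  (forall g m u : nat, 0 < g -> 0 < m ->
     ((g %% 6 = 1 /\ m %% 6 = 4) \/ (g %% 6 = 5 /\ m %% 6 = 2)) ->
     (u = 21 \/ u = 33) ->
     g <= m -> 2 * m <= g * (u - 1) ->
     exists_4GDD [:: (g, u); (m, 1)])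
  /\
  (forall g m : nat, 0 < g -> 0 < m ->
     (g %% 30 = 1 \/ g %% 30 = 11) -> m %% 3 = g %% 3 ->
     g <= m -> 5 * m <= 56 * g - 6 ->
     exists_4GDD [:: (g, 24); (m, 1)]).
Proof.
split=> [g m u _ _ gm6 u_eq gm mg|g m _ _ g30 m3 gm mg].
  have gE : g = g./2.*2.+1 by lia.
  (* The congruences and g <= m force m >= g + 3 = 4 + 2k with k = [g./2], so the subtraction is
     exact. *)
  have mE : m = 4 + 2 * g./2 + 6 * ((m - 4 - 2 * g./2) %/ 6) by lia.
  have g3 : g./2 %% 3 != 1 by lia.
  rewrite gE mE; case: u_eq mg => -> mg.
    by apply: exists_4GDD_21; lia.
  by apply: exists_4GDD_33; lia.
have gE : g = g./2.*2.+1 by lia.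
have mE : m = 1 + 2 * g./2 + 3 * ((m - 1 - 2 * g./2) %/ 3) by lia.
by rewrite gE mE; apply: exists_4GDD_24; lia.
Qed.
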